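(* Let $f,g,k_x,k_y$ satisfy the plant assumption, let $\Phi=\Phi_u+\Phi_y$ and $\mathcal U$ satisfy the cost assumption, let the plant be monotone with respect to orthants $\mathcal K_U\subset\mathbb R^m$, $\mathcal K_X\subset\mathbb R^n$, $\mathcal K_Y\subset\mathbb R^p$, and let $\alpha>0$ be arbitrary (all as described in the context). Consider the controller subsystem with input $x(\cdot)$ and state $v\in\mathcal U$, $$\dot v=\Pi_{\mathcal U}\bigl(v,-\alpha\nabla\Phi_u(v)-\alpha\nabla k_y(v)^\top\nabla\Phi_y(g(x))\bigr),\qquad (\mathrm V)$$ and write $v(t,v_0,x)$ for its solution at time $t$ with initial condition $v_0\in\mathcal U$ and input $x(\cdot)$. Assume the following. (i) There is an orthant $\mathcal K_V\subset\mathbb R^m$ such that, with $\mathcal K_Z:=-\mathcal K_U$, the subsystem $(\mathrm V)$ with output $z=v$ is monotone with respect to $\mathcal K_X,\mathcal K_V,\mathcal K_Z$: if $x(t)\succcurlyeq_{\mathcal K_X}x'(t)$ for all $t$ and $v_0\succcurlyeq_{\mathcal K_V}v_0'$, then $v(t,v_0,x)\succcurlyeq_{\mathcal K_V}v(t,v_0',x')$ for all $t\ge 0$; and furthermore $v\succcurlyeq_{\mathcal K_V}v'$ implies $v\succcurlyeq_{\mathcal K_Z}v'$. (ii) The subsystem $(\mathrm V)$ admits a well-defined steady-state map $k_v:\mathbb R^n\to\mathbb R^m$: for every constant input $x\in\mathbb R^n$ (and every initial condition in $\mathcal U$), the solution of $(\mathrm V)$ converges to $k_v(x)$. Furthermore,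 $k_v$ is continuous. (iii) There is a unique $u^\star\in\mathcal U$ such that, for every $u_0\in\mathcal U$, the iteration $$u_{j+1}=\operatorname*{argmin}_{u\in\mathcal U}\ \Phi_u(u)+k_y(u)^\top\nabla\Phi_y(k_y(u_j)),\qquad j=0,1,2,\dots$$ converges to $u^\star$. Then, for any $x_0\in\mathbb R^n$ and $u_0\in\mathcal U$, the solution $(x(t),u(t))$ of the closed-loop system $$\dot x=f(x,u),\qquad \dot u=\Pi_{\mathcal U}\bigl(u,-\alpha\nabla\Phi_u(u)-\alpha\nabla k_y(u)^\top\nabla\Phi_y(g(x))\bigr),\qquad x(0)=x_0,\ u(0)=u_0,$$ converges, as $t\to\infty$, to $(x^\star,u^\star)$, where $u^\star$ is the unique minimizer of $\tilde\Phi(u):=\Phi_u(u)+\Phi_y(k_y(u))$ over $u\in\mathcal U$ and $x^\star=k_x(u^\star)$. This holds for any $\alpha>0$.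
   Context: **Notation.** For differentiable $h:\mathbb R^a\to\mathbb R^b$, $\nabla h(x)\in\mathbb R^{b\times a}$ is the Jacobian; for scalar $h$, $\nabla h(x)$ also denotes the gradient (column vector). For a closed convex set $S\subseteq\mathbb R^n$, $\mathrm T_S(x)=\operatorname{cl}\bigl(\bigcup_{\delta>0}\frac1\delta(S-x)\bigr)$ is the tangent cone at $x\in S$, and $\Pi_S(x,v)$ is the Euclidean projection of $v$ onto $\mathrm T_S(x)$. All solutions of differential equations are in the Carathéodory sense (absolutely continuous, satisfying the equation for almost all $t$). **Orders.** An orthant in $\mathbb R^n$ is a set $\mathcal K=\{x\in\mathbb R^n: (-1)^{\epsilon_i}x_i\ge 0\ \forall i\}$ for some $\epsilon\in\{0,1\}^n$. It induces the partial order $x\succcurlyeq_{\mathcal K}y\iff x-y\in\mathcal K$. **Monotone system.** A system $\dot x=f(x,u)$, $y=g(x)$ is monotone with respect to orthants $\mathcal K_U,\mathcal K_X,\mathcal K_Y$ (in input, state and output space) if (1) for any two measurable, locally bounded inputs with $u(t)\succcurlyeq_{\mathcal K_U}u'(t)$ for almost all $t$ and any initial conditions $x_0\succcurlyeq_{\mathcal K_X}x_0'$, the corresponding solutions (assumed well defined) satisfy $x(t,x_0,u)\succcurlyeq_{\mathcal K_X}x(t,x_0',u')$ for all $t\ge 0$; and (2) $x\succcurlyeq_{\mathcal K_X}x'$ implies $g(x)\succcurlyeq_{\mathcal K_Y}g(x')$. **Plant assumption.** The plant is $\dot x=f(x,u)$, $y=g(x)$ with $f:\mathbb R^n\times\mathbb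 R^m\to\mathbb R^n$ and $g:\mathbb R^n\to\mathbb R^p$ locally Lipschitz. There is a continuous steady-state map $k_x:\mathbb R^m\to\mathbb R^n$: for every constant input $\bar u\in\mathbb R^m$ and every initial condition, the solution of the plant converges to $k_x(\bar u)$ as $t\to\infty$. The steady-state output map is $k_y:=g\circ k_x:\mathbb R^m\to\mathbb R^p$; it is continuously differentiable and $\nabla k_y:\mathbb R^m\to\mathbb R^{p\times m}$ is locally Lipschitz. **Cost assumption.** $\Phi(u,y)=\Phi_u(u)+\Phi_y(y)$ with $\Phi:\mathbb R^m\times\mathbb R^p\to\mathbb R$ continuously differentiable and $\nabla\Phi$ locally Lipschitz. The set $\mathcal U=[u_1^{\min},u_1^{\max}]\times\dots\times[u_m^{\min},u_m^{\max}]\subset\mathbb R^m$ is a compact box. *)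

(* Defs.v *)
From HB Require Import structures.
From mathcomp Require Import all_boot all_order all_algebra.
From mathcomp Require Import all_classical all_reals all_analysis.
Set Implicit Arguments.
Unset Strict Implicit.
Unset Printing Implicit Defensive.
Import Order.TTheory GRing.Theory Num.Theory.
Import numFieldNormedType.Exports.
Local Open Scope classical_set_scope.
Local Open Scope ring_scope.

(* Points of R^n are row vectors 'rV[R]_n.
   Their library norm is the sup norm; it is used for topology, boundedness,
   Lipschitz and absolute continuity only, where the choice of norm is
   immaterial.  Projections use [enorm]. *)

Section Definitions.
Context {R : realType}.

Definition dot n (x y : 'rV[R]_n) : R := \sum_(i < n) x 0 i * y 0 i.

Definition enorm n (x : 'rV[R]_n) : R := Num.sqrt (dot x x).

Definition locally_lipschitz (V W : normedModType R) (h : V -> W) : Prop :=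
  forall x : V, exists2 A : set V, nbhs x A & [lipschitz h z | z in A].

Definition grad n (h : 'rV[R]_n -> R) (x : 'rV[R]_n) : 'rV[R]_n :=
  \row_(i < n) 'D_(delta_mx 0 i : 'rV[R]_n) h x.

(* The library's ['J h x] acts on row vectors ([v *m 'J h x] is the
   differential at [v]), so it is the transpose of the usual b x a Jacobian. *)
Definition jac a b (h : 'rV[R]_a -> 'rV[R]_b) (x : 'rV[R]_a) : 'M[R]_(b, a) :=
  ('J h x)^T.

Definition C1_scalar n (h : 'rV[R]_n -> R) : Prop :=
  (forall x, differentiable h x) /\ continuous (grad h).

Definition C1_vector a b (h : 'rV[R]_a -> 'rV[R]_b) : Prop :=
  (forall x, differentiable h x) /\ continuous (jac h).

Definition tangent_cone n (S : set 'rV[R]_n) (x : 'rV[R]_n) : set 'rV[R]_n :=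
  closure (\bigcup_(d in [set d : R | 0 < d])
             [set d^-1 *: (s - x) | s in S]).

(* The default value 0 is irrelevant for S closed convex and x in S: the
   tangent cone is then closed, convex and nonempty, so that the nearest point
   exists and is unique. *)
Definition tangent_proj n (S : set 'rV[R]_n) (x v : 'rV[R]_n) : 'rV[R]_n :=
  xget 0 [set p | tangent_cone S x p /\
                  forall q, tangent_cone S x q -> enorm (v - p) <= enorm (v - q)].

Definition is_orthant n (K : set 'rV[R]_n) : Prop :=
  exists eps : 'I_n -> bool,
    K = [set x | forall i, 0 <= (-1) ^+ (eps i) * x 0 i].

Definition succeq n (K : set 'rV[R]_n) (x y : 'rV[R]_n) : Prop := K (x - y).

Definition box n (lo hi : 'rV[R]_n) : set 'rV[R]_n :=
  [set u | forall i, lo 0 i <= u 0 i <= hi 0 i].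

Definition argmin (T : Type) (S : set T) (h : T -> R) : set T :=
  [set u | S u /\ forall w, S w -> h u <= h w].

Definition absolutely_continuous (V : normedModType R) (a b : R) (x : R -> V) :
    Prop :=
  forall e : R, 0 < e -> exists2 d : R, 0 < d &
    forall (N : nat) (s t : 'I_N -> R),
      (forall i, a <= s i /\ s i <= t i /\ t i <= b) ->
      (forall i j, i != j -> t i <= s j \/ t j <= s i) ->
      \sum_(i < N) (t i - s i) < d ->
      \sum_(i < N) `|x (t i) - x (s i)| < e.

(* Signals are functions on the whole real line of which only the restriction
   to [0, +oo) matters. *)

(* [x] is a Caratheodory solution on [0, +oo), staying in the state space [D],
   of x' = F(x, w), x(0) = x0. *)
Definition solution n k (D : set 'rV[R]_n) (F : 'rV[R]_n -> 'rV[R]_k -> 'rV[R]_n)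
    (x0 : 'rV[R]_n) (w : R -> 'rV[R]_k) (x : R -> 'rV[R]_n) : Prop :=
  [/\ x 0 = x0,
      forall t, 0 <= t -> D (x t),
      forall T, absolutely_continuous 0 T x &
      {ae (@lebesgue_measure R), forall t : R, 0 < t ->
         is_derive t 1 x (F (x t) (w t))}].

Definition admissible_input k (w : R -> 'rV[R]_k) : Prop :=
  (forall i : 'I_k,
     measurable_fun (`[0, +oo[ : set R) (fun t : R => w t 0 i : R)) /\
  (forall T : R, [bounded w t | t in `[0, T]]).

Definition well_posed n k (D : set 'rV[R]_n)
    (F : 'rV[R]_n -> 'rV[R]_k -> 'rV[R]_n) : Prop :=
  forall (w : R -> 'rV[R]_k) (x0 : 'rV[R]_n), admissible_input w -> D x0 ->
    exists2 x, solution D F x0 w x &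
      forall x', solution D F x0 w x' -> forall t, 0 <= t -> x' t = x t.

Definition succeq_ae k (K : set 'rV[R]_k) (w w' : R -> 'rV[R]_k) : Prop :=
  {ae (@lebesgue_measure R), forall t : R, 0 <= t -> succeq K (w t) (w' t)}.

Definition succeq_everywhere k (K : set 'rV[R]_k) (w w' : R -> 'rV[R]_k) : Prop :=
  forall t : R, 0 <= t -> succeq K (w t) (w' t).

(* Monotonicity of x' = F(x, w), y = h(x) with state space [D]; [ordW] is the
   order on input signals ([succeq_ae K] or [succeq_everywhere K]). *)
Definition monotone_system n k l (D : set 'rV[R]_n)
    (F : 'rV[R]_n -> 'rV[R]_k -> 'rV[R]_n) (h : 'rV[R]_n -> 'rV[R]_l)
    (ordW : (R -> 'rV[R]_k) -> (R -> 'rV[R]_k) -> Prop)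
    (KX : set 'rV[R]_n) (KY : set 'rV[R]_l) : Prop :=
  [/\ well_posed D F,
      forall (w w' : R -> 'rV[R]_k) (x0 x0' : 'rV[R]_n),
        admissible_input w -> admissible_input w' -> ordW w w' ->
        D x0 -> D x0' -> succeq KX x0 x0' ->
        forall x x', solution D F x0 w x -> solution D F x0' w' x' ->
        forall t, 0 <= t -> succeq KX (x t) (x' t) &
      forall x x', D x -> D x' -> succeq KX x x' -> succeq KY (h x) (h x')].

Definition steady_state_map n k (D : set 'rV[R]_n)
    (F : 'rV[R]_n -> 'rV[R]_k -> 'rV[R]_n) (kss : 'rV[R]_k -> 'rV[R]_n) : Prop :=
  continuous kss /\
  forall (wbar : 'rV[R]_k) (x0 : 'rV[R]_n), D x0 ->
    forall x, solution D F x0 (fun=> wbar) x -> x t @[t --> +oo] --> kss wbar.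

Definition plant_assumption n m p (f : 'rV[R]_n -> 'rV[R]_m -> 'rV[R]_n)
    (g : 'rV[R]_n -> 'rV[R]_p) (kx : 'rV[R]_m -> 'rV[R]_n)
    (ky : 'rV[R]_m -> 'rV[R]_p) : Prop :=
  locally_lipschitz (fun z : 'rV[R]_n * 'rV[R]_m => f z.1 z.2) /\
  locally_lipschitz g /\
  steady_state_map setT f kx /\
  ky = g \o kx /\
  C1_vector ky /\
  locally_lipschitz (jac ky).

(* R^m x R^p is identified with R^(m+p) so that the gradient of [Phi] is a
   vector. *)
Definition cost_assumption m p (Phi : 'rV[R]_m -> 'rV[R]_p -> R)
    (Phiu : 'rV[R]_m -> R) (Phiy : 'rV[R]_p -> R) : Prop :=
  let Phi' := fun z : 'rV[R]_(m + p) => Phi (lsubmx z) (rsubmx z) in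
  (forall u y, Phi u y = Phiu u + Phiy y) /\
  C1_scalar Phi' /\
  locally_lipschitz (grad Phi').

(* [grad Phiy (g x) *m jac ky v] is the row-vector form of
   (nabla ky(v))^T (nabla Phiy(g(x))). *)
Definition controller_field n m p (alpha : R) (U : set 'rV[R]_m)
    (Phiu : 'rV[R]_m -> R) (Phiy : 'rV[R]_p -> R) (ky : 'rV[R]_m -> 'rV[R]_p)
    (g : 'rV[R]_n -> 'rV[R]_p) (v : 'rV[R]_m) (x : 'rV[R]_n) : 'rV[R]_m :=
  tangent_proj U v
    (- alpha *: grad Phiu v - alpha *: (grad Phiy (g x) *m jac ky v)).

Definition iteration_converges_to m p (U : set 'rV[R]_m)
    (Phiu : 'rV[R]_m -> R) (Phiy : 'rV[R]_p -> R) (ky : 'rV[R]_m -> 'rV[R]_p)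
    (ustar : 'rV[R]_m) : Prop :=
  forall u : nat -> 'rV[R]_m, U (u 0%N) ->
    (forall j, argmin U (fun w => Phiu w + dot (ky w) (grad Phiy (ky (u j))))
                 (u j.+1)) ->
    u @ \oo --> ustar.

End Definitions.

(* Main.v *)
Require Import Defs.
From HB Require Import structures.
From mathcomp Require Import all_boot all_order all_algebra.
From mathcomp Require Import all_classical all_reals all_analysis.
From mathcomp Require Import measurable_realfun ring lra.
Import Order.TTheory GRing.Theory Num.Theory.
Import numFieldNormedType.Exports.
Local Open Scope classical_set_scope.
Local Open Scope ring_scope.

(** The theorem is a small-gain argument for the negative feedback of two
    monotone systems, combined with the observation that the loop of their
    steady-state maps is one step of the iteration of hypothesis (iii).

    Write [kappa w = kv (kx w)].  With its input frozen at [kx w], the controller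
    is the projected gradient flow, on the box, of the cost with [Phiy] linearized
    at [ky w], that is of [Phiu v + <ky v, grad Phiy (ky w)>].  This cost decreases along
    trajectories ([projected_gradient_descent]), and all of them converge to
    [kappa w], so [kappa w] minimizes it ([steady_state_argmin]): the iterates
    of [kappa] are an instance of the iteration and tend to [ustar] from every
    point of the box.  A minimizer of the total cost satisfies the first-order
    condition, hence is a rest point of the controller frozen at [kx w], hence a
    fixed point of [kappa] ([minimizer_fixed_point]), hence equal to [ustar];
    minimizers exist by compactness.

    For the closed loop, an asymptotic lower bound [a] for the input of a
    monotone system gives the asymptotic lower bound [kss a] for its state
    ([eventually_above_steady_state]).  Around the loop, lower bounds [a] for
    [u] become upper bounds [kappa a], because the controller output is ordered
    by the opposite of the input order of the plant; twice around the loop they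
    become lower bounds [kappa (kappa a)].  Starting from the two extreme
    corners of the box, the even iterates of [kappa] bound [u] from below and
    from above, and both tend to [ustar].

    The analytic point is the descent property: solutions are only absolutely
    continuous and satisfy their equation almost everywhere, so one needs that
    an absolutely continuous function with almost everywhere non-positive
    derivative is nonincreasing ([ae_derive_le0_nonincreasing]). *)

Set Implicit Arguments.
Unset Strict Implicit.
Unset Printing Implicit Defensive.

(** * Absolutely continuous functions *)

Section AbsolutelyContinuous.
Context {R : realType}.
Local Notation mu := (@lebesgue_measure R).

Definition ocitvs (l : seq (R * R)) : set R :=
  [set x | exists2 I, I \in l & I.1 < x <= I.2].

Lemma measure_ocitvs (l : seq (R * R)) :
  (forall I, I \in l -> I.1 <= I.2) -> pairwise (fun I J => J.2 <= I.1) l ->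
  measurable (ocitvs l) /\ mu (ocitvs l) = (\sum_(I <- l) (I.2 - I.1))%:E.
Proof.
elim: l => [|I l IH] /=.
  move=> _ _; rewrite big_nil.
  have -> : ocitvs [::] = set0 by rewrite -subset0 => x [].
  by rewrite measure0; split.
move=> le_l /andP[/allP sepI sep_l].
have [||ml mul] := IH => //.
  by move=> J Jl; apply: le_l; rewrite inE Jl orbT.
have -> : ocitvs (I :: l) = `]I.1, I.2] `|` ocitvs l.
  apply/seteqP; split => x /=.
    move=> [J]; rewrite inE => /orP[/eqP ->|Jl] xJ; first by left; rewrite /= in_itv.
    by right; exists J.
  move=> [|[J Jl xJ]]; first by rewrite /= in_itv/= => xI; exists I; rewrite // inE eqxx.
  by exists J => //; rewrite inE Jl orbT.
split; first exact: measurableU.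
have -> : mu (`]I.1, I.2] `|` ocitvs l) = (mu `]I.1, I.2] + mu (ocitvs l))%E.
  apply: measureU => //.
  rewrite -subset0 => x [/=]; rewrite in_itv /= => /andP[Ix _] [J Jl /andP[_ xJ]].
  by have := sepI _ Jl; rewrite leNgt (lt_le_trans Ix xJ).
rewrite mul lebesgue_measure_itv /= big_cons EFinD lte_fin.
have := le_l I (mem_head _ _); rewrite le_eqVlt => /orP[/eqP ->|->//].
by rewrite ltxx subrr.
Qed.

(** Families of intervals produced one at a time are lists; a list ordered from
    right to left is a family of non-overlapping intervals in the sense of
    [absolutely_continuous]. *)
Lemma absolutely_continuous_seq (V : normedModType R) (a b : R) (F : R -> V) :
  absolutely_continuous a b F ->
  forall e, 0 < e -> exists2 d, 0 < d &
    forall l : seq (R * R), (forall I, I \in l -> a <= I.1 /\ I.1 <= I.2 /\ I.2 <= b) ->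
      pairwise (fun I J => J.2 <= I.1) l -> \sum_(I <- l) (I.2 - I.1) < d ->
      \sum_(I <- l) `|F I.2 - F I.1| < e.
Proof.
move=> acF e e0; have [d d0 H] := acF e e0; exists d => // l lab sep.
rewrite big_tnth => ltd; rewrite big_tnth.
apply: (H _ (fun i => (tnth (in_tuple l) i).1) (fun i => (tnth (in_tuple l) i).2)) => //.
  by move=> i; apply: lab; exact: mem_tnth.
move=> i j ij; have /pairwiseP := sep => /(_ (0, 0)) {}sep.
rewrite !(tnth_nth (0, 0)) /=.
case: (ltngtP i j) => [lij|lij|/val_inj eij]; last by rewrite eij eqxx in ij.
  by right; apply: sep => //; rewrite inE.
by left; apply: sep => //; rewrite inE.
Qed.

(** Real induction, the form of completeness used to glue local estimates
    without choosing a tagged partition: the supremum of the reachable points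
    is reachable and cannot be smaller than [b], because [P] passes from the
    left to the right of every point. *)
Lemma real_induction (a b : R) (P : R -> Prop) : a <= b -> P a ->
  (forall c, a <= c <= b -> exists2 r, 0 < r &
     forall s s', s \in `]c - r, c] -> s' \in `[c, c + r[ -> a <= s -> s' <= b ->
       P s -> P s') ->
  P b.
Proof.
move=> ab Pa step; pose S := [set c | a <= c <= b /\ P c].
have Sa : S a by split => //; rewrite lexx.
have ubS : ubound S b by move=> c [/andP[]].
have hS : has_sup S by split; [exists a | exists b].
have supab : a <= sup S <= b.
  by rewrite (sup_upper_bound hS) //= ge_sup //; exists a.
have [r r0 Pr] := step _ supab.
have [s [/andP[sa sb] Ps] ltS] := sup_adherent r0 hS.
have ssup : s \in `](sup S - r), sup S].
  by rewrite in_itv /= ltS (sup_upper_bound hS) //; split => //; apply/andP.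
have [bS|Sb] := leP b (sup S).
  apply: Pr ssup _ sa (lexx b) Ps.
  by rewrite in_itv/= (andP supab).2 (le_lt_trans bS) // ltrDl.
pose s' := Num.min b (sup S + r / 2).
have s'S : sup S < s' by rewrite lt_min Sb ltrDl divr_gt0.
have Ps' : P s'.
  apply: Pr ssup _ sa _ Ps; last by rewrite ge_min lexx.
  rewrite in_itv /= (ltW s'S) /= gt_min; apply/orP; right; rewrite ltrD2l.
  by rewrite ltr_pdivrMr // ltr_pMr // ltr1n.
have : S s'.
  split=> //; rewrite ge_min lexx /= andbT (le_trans (andP supab).1) //.
  exact: ltW.
by move=> /(sup_upper_bound hS); rewrite leNgt s'S.
Qed.

Lemma derive_le0_local (F : R -> R) (c e : R) : 0 < e ->
  derivable F c 1 -> 'D_1 F c <= 0 ->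
  exists2 r, 0 < r & forall s, `|s - c| < r ->
    (s <= c -> F c - F s <= e * (c - s)) /\ (c <= s -> F s - F c <= e * (s - c)).
Proof.
move=> e0 dF dF0.
have /cvgrPdist_le /(_ e e0) : h^-1 *: (F (h *: 1 + c) - F c) @[h --> 0^'] --> 'D_1 F c.
  exact: dF.
rewrite near_withinE => /nbhs_ballP [r /= r0 H]; exists r => // s scr.
have [->|sc] := eqVneq s c; first by rewrite !subrr mulr0.
have := H (s - c); rewrite /ball /= sub0r normrN subr_eq0 => /(_ scr sc).
have -> : (s - c) *: 1 + c = s by rewrite [_ *: _]mulr1 subrK.
rewrite ler_norml => /andP[H1 _].
have : (s - c)^-1 * (F s - F c) <= e.
  by move: H1; rewrite -[_ *: (F s - F c)]/((s - c)^-1 * (F s - F c)); lra.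
move=> H2; split => [le|le].
  have lt : 0 < c - s by rewrite subr_gt0 lt_neqAle sc.
  have : (c - s)^-1 * (F c - F s) <= e.
    by rewrite -[c - s]opprB invrN -[F c - F s]opprB mulrNN.
  by rewrite mulrC ler_pdivrMr.
have lt : 0 < s - c by rewrite subr_gt0 lt_neqAle eq_sym sc.
by move: H2; rewrite mulrC ler_pdivrMr.
Qed.

(** Away from a null set [N], a non-positive derivative controls the growth of
    [F] near each point by [e] times the length.  Near the points of [N]
    nothing is known about the derivative, but [N] has an open neighbourhood
    [W] of measure less than [d / 2], and the increments of [F] over
    non-overlapping intervals inside [W] add up to less than [e] by absolute
    continuity.  Real induction on [c] splits [[a, c]] into pieces of these two
    kinds; the list [l] records those of the second kind. *)
Lemma ae_derive_le0_nonincreasing (F : R -> R) (a b : R) : a <= b ->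
  absolutely_continuous a b F ->
  {ae mu, forall t, a < t -> derivable F t 1 /\ 'D_1 F t <= 0} ->
  F b <= F a.
Proof.
move=> ab acF aeF; apply/ler_addgt0Pr => e0 e0_gt0.
pose e := e0 / (1 + (b - a)).
have ba1 : 0 < 1 + (b - a) by rewrite ltr_pwDl // subr_ge0.
have e_gt0 : 0 < e by rewrite divr_gt0.
have [d d0 Hd] := absolutely_continuous_seq acF e_gt0.
(* The left end point joins the exceptional set, as only [a < t] is controlled. *)
pose N := [set a] `|` ~` [set t | a < t -> derivable F t 1 /\ 'D_1 F t <= 0].
have : mu.-negligible N.
  apply: negligibleU => //; exists [set a]; split => //.
  exact: lebesgue_measure_set1.
move=> /negligible_outer_measure N0.
have [W [oW NW]] := @outer_measure_open_le R N (d / 2) (divr_gt0 d0 (ltr0Sn _ 1)).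
rewrite N0 add0e => muW.
pose P c := exists l : seq (R * R),
  [/\ forall I, I \in l -> [/\ a <= I.1, I.1 <= I.2, I.2 <= c & `[I.1, I.2] `<=` W],
      pairwise (fun I J => J.2 <= I.1) l &
      F c - F a <= e * (c - a) + \sum_(I <- l) (F I.2 - F I.1)].
have : P b.
  apply: (@real_induction a) => //.
    by exists [::]; split => //; rewrite big_nil !subrr mulr0 addr0.
  move=> c /andP[ac cb]; have [cN|cN] := pselect (N c).
    have /nbhs_ballP[r /= r0 cW] : nbhs c W by apply: open_nbhs_nbhs; split=> //; exact: NW.
    exists r => // s s'; rewrite !in_itv/= => /andP[s1 s2] /andP[s'1 s'2] sa s'b.
    move=> [l [lW sep leF]]; exists ((s, s') :: l); split.
    - move=> I; rewrite inE => /orP[/eqP->/=|Il].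
        split=> //; first exact: le_trans s'1.
        move=> x /=; rewrite in_itv/= => /andP[sx xs']; apply: cW.
        by rewrite /ball /= ltr_distl; apply/andP; split; lra.
      have [? ? ? ?] := lW _ Il; split => //.
      by apply: le_trans s'1; apply: le_trans s2.
    - rewrite /= sep andbT; apply/allP => I /lW[] //.
    - rewrite big_cons /=.
      have : e * (s - a) <= e * (s' - a).
        by rewrite ler_pM2l // lerD2r (le_trans s2).
      by move: leF; lra.
  have /derive_le0_local : 0 < e by [].
  move=> /(_ F c).
  have ltac : a < c.
    by rewrite lt_neqAle ac andbT; apply/eqP => ec; apply: cN; left.
  have [dF dF0] : derivable F c 1 /\ 'D_1 F c <= 0.
    by apply: contrapT => H; apply: cN; right => /=; move=> /(_ ltac).
  move=> /(_ dF dF0) [r r0 Hr].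
  exists r => // s s'; rewrite !in_itv/= => /andP[s1 s2] /andP[s'1 s'2] sa s'b.
  move=> [l [lW sep leF]]; exists l; split => //.
    move=> I /lW[? ? ? ?]; split => //.
    by apply: le_trans s'1; apply: le_trans s2.
  have /Hr[/(_ s2) Fs _] : `|s - c| < r.
    by rewrite ltr_distl; apply/andP; split; lra.
  have /Hr[_ /(_ s'1) Fs'] : `|s' - c| < r.
    by rewrite ltr_distl; apply/andP; split; lra.
  by move: leF Fs Fs'; rewrite !mulrBr; lra.
move=> [l [lW sep leF]].
have [|ml mul] := @measure_ocitvs l _ sep; first by move=> I /lW[].
have : \sum_(I <- l) (I.2 - I.1) < d.
  rewrite -lte_fin -mul; apply: (@le_lt_trans _ _ (d / 2)%:E).
    apply: le_trans muW; apply: le_measure; rewrite ?inE //.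
      exact: measurable_realfun.open_measurable.
    move=> x [I /lW[_ _ _ IW] /andP[Ix xI]]; apply: IW.
    by rewrite /= in_itv /= (ltW Ix).
  by rewrite lte_fin; lra.
move=> /Hd => /(_ _ sep) Hl.
have : \sum_(I <- l) (F I.2 - F I.1) < e.
  apply: le_lt_trans (Hl _); last by move=> I /lW[].
  by apply: ler_sum => I _; exact: ler_norm.
move=> sume.
have : e * (1 + (b - a)) = e0 by rewrite /e divfK // gt_eqF.
by move: leF sume; rewrite [_ * (1 + _)]mulrDr mulr1; lra.
Qed.

End AbsolutelyContinuous.

(** * Solutions and time shifts *)

Section Solutions.
Context {R : realType}.
Local Notation mu := (@lebesgue_measure R).

Lemma measurable_shift (T : R) :
  measurable_fun [set: measurableTypeR R]
    (fun t => T + t : measurableTypeR R).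
Proof. exact: measurable_funD. Qed.

Lemma lebesgue_measure_shift (T : R) (A : set R) : measurable A ->
  pushforward mu (fun t => T + t : measurableTypeR R) A = mu A.
Proof.
move=> mA; apply/esym/lebesgue_measure_unique => //=.
  exact: measurable_shift.
move=> _ _ [[a b]] _ <-; rewrite /pushforward.
have -> : (fun t => T + t) @^-1` `]a, b] = [set` `](a - T), (b - T)]%R].
  by apply/seteqP; split => t /=; rewrite !in_itv /=; lra.
rewrite !lebesgue_measure_itv /= !lte_fin ltrD2r.
by case: ifP => // _; rewrite -!EFinD; congr EFin; ring.
Qed.

Lemma ae_shift (T : R) (P : R -> Prop) :
  {ae mu, forall t, P t} -> {ae mu, forall t, P (T + t)}.
Proof.
move=> [A [mA A0 PA]]; exists ((fun t => T + t) @^-1` A); split.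
- by have := measurable_shift T measurableT mA; rewrite setTI.
- by rewrite -A0 -(lebesgue_measure_shift T mA).
- by move=> t /= Pt; apply: PA.
Qed.

Lemma ae_sub (P Q : R -> Prop) : (forall t, P t -> Q t) ->
  {ae mu, forall t, P t} -> {ae mu, forall t, Q t}.
Proof. by move=> PQ; apply: negligibleS => t /= nQ /PQ. Qed.

Lemma is_derive_shift_arg (V : normedModType R) (x : R -> V) (T t : R) (d : V) :
  is_derive (T + t) 1 x d -> is_derive t 1 (fun s => x (T + s)) d.
Proof.
have E : (fun h : R => h^-1 *: (((fun s => x (T + s)) \o shift t) (h *: 1) - x (T + t)))
  = (fun h => h^-1 *: ((x \o shift (T + t)) (h *: 1) - x (T + t))).
  by apply/funext => h /=; rewrite addrCA.
by move=> [dx dxE]; split; [rewrite /derivable E | rewrite /derive E].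
Qed.

Lemma absolutely_continuous_shift (V : normedModType R) (x : R -> V) (T S : R) :
  0 <= T -> absolutely_continuous 0 (T + S) x ->
  absolutely_continuous 0 S (fun t => x (T + t)).
Proof.
move=> T0 acx e /acx[d d0 H]; exists d => // N s t st sep ltd.
apply: (H N (fun i => T + s i) (fun i => T + t i)).
- by move=> i; have [? []] := st i; rewrite !lerD2l addr_ge0.
- by move=> i j /sep; rewrite !lerD2l.
- by under eq_bigr do rewrite opprD addrACA subrr add0r.
Qed.

(** Autonomy of the system: the constant-input comparison can be started at any
    time, provided that exceptional null sets are translation invariant. *)
Lemma solution_shift n k (D : set 'rV[R]_n) F (x0 : 'rV[R]_n) (w : R -> 'rV[R]_k) x T :
  0 <= T -> solution D F x0 w x ->
  solution D F (x T) (fun t => w (T + t)) (fun t => x (T + t)).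
Proof.
move=> T0 [_ xD acx aex]; split.
- by rewrite addr0.
- by move=> t t0; apply: xD; rewrite addr_ge0.
- by move=> S; apply: absolutely_continuous_shift.
- apply: ae_sub (ae_shift T aex) => t H t0.
  by apply: is_derive_shift_arg; apply: H; rewrite ltr_wpDl.
Qed.

Lemma absolutely_continuous_within (V : normedModType R) (x : R -> V) :
  (forall T, absolutely_continuous 0 T x) -> {within `[0, +oo[, continuous x}.
Proof.
move=> acx; apply/subspace_continuousP => t /=; rewrite in_itv /= andbT => t0.
apply/cvgrPdist_lt => e e0; rewrite near_withinE.
have [d d0 H] := acx (t + 1) e e0.
near=> s; rewrite /= in_itv /= andbT => s0.
have st : `|t - s| < d.
  by near: s; apply/nbhs_ballP; exists d.
have st1 : `|t - s| < 1.
  by near: s; apply/nbhs_ballP; exists 1 => //=.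
have := H 1%N (fun=> Num.min s t) (fun=> Num.max s t).
rewrite !big_ord1 maxr_absE minr_absE.
have -> : (s + t + `|s - t|) / 2 - (s + t - `|s - t|) / 2 = `|s - t|.
  by field.
rewrite -maxr_absE -minr_absE [`|s - t|]distrC.
move: st1; rewrite ltr_norml => /andP[st1 st2].
case: (leP s t) => ls; [|rewrite [`|x s - _|]distrC] => HH.
all: apply: HH => // [_|i j]; last by rewrite !ord1 eqxx.
all: by split => //; split => //; lra.
Unshelve. all: by end_near. Qed.

(** In a feedback loop the state of one subsystem is the input of the other. *)
Lemma solution_admissible n k (D : set 'rV[R]_n) F (x0 : 'rV[R]_n) (w : R -> 'rV[R]_k) x :
  solution D F x0 w x -> admissible_input x.
Proof.
move=> [_ _ /absolutely_continuous_within cx _]; split => [i|T].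
  apply: subspace_continuous_measurable_fun => //.
  move=> t; exact: (cvg_comp _ _ (cx t) (@coord_continuous _ _ _ 0 i (x t))).
have /compact_bounded : compact (x @` `[0, T]).
  apply: continuous_compact; last exact: segment_compact.
  apply: continuous_subspaceW cx => t /=; rewrite !in_itv /= => /andP[->] //.
rewrite /= /bounded_near; apply: (@filterS _ (pinfty_nbhs R)) => M H t tT.
by apply: H; exists t.
Qed.

Lemma cst_admissible k (c : 'rV[R]_k) : admissible_input (fun=> c).
Proof.
split=> [i|T]; first exact: measurable_cst.
rewrite /bounded_near; apply: (@filterS _ (pinfty_nbhs R)) (nbhs_pinfty_ge (num_real `|c|)).
by move=> M cM t _; exact: cM.
Qed.

End Solutions.

(** * Vectors, matrices and gradients *)

Section Matrices.
Context {R : realType}.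

Lemma le_coord_norm m n (x : 'M[R]_(m, n)) i j : `|x i j| <= `|x|.
Proof.
rewrite [leRHS]/Num.Def.normr /= mx_normrE; apply/bigmax_geP; right.
by exists (i, j).
Qed.

Lemma norm_lt_coord m n (x : 'M[R]_(m, n)) e : 0 < e ->
  (forall i j, `|x i j| < e) -> `|x| < e.
Proof.
move=> e0 H; rewrite [ltLHS]/Num.Def.normr /= mx_normrE.
by apply/bigmax_ltP; split => // -[i j] _ /=.
Qed.

Lemma cvg_mx_coord (T : Type) (F : set_system T) (FF : Filter F) m n
    (f : T -> 'M[R]_(m, n)) (l : 'M[R]_(m, n)) :
  (forall i j, f t i j @[t --> F] --> l i j) -> f @ F --> l.
Proof.
move=> H; apply/cvgrPdist_lt => e e0.
have : \forall t \near F, forall ij : 'I_m * 'I_n, `|l ij.1 ij.2 - f t ij.1 ij.2| < e.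
  by apply: filter_forall => -[i j] /=; move: (H i j) => /cvgrPdist_lt; apply.
apply: filterS => t Ht; apply: norm_lt_coord => // i j.
by rewrite !mxE; exact: (Ht (i, j)).
Qed.

Lemma cvg_mulmx (T : Type) (F : set_system T) (FF : Filter F) m n p
    (f : T -> 'M[R]_(m, n)) (g : T -> 'M[R]_(n, p)) (a : 'M[R]_(m, n)) (b : 'M[R]_(n, p)) :
  f @ F --> a -> g @ F --> b -> f t *m g t @[t --> F] --> a *m b.
Proof.
move=> fa gb; apply: cvg_mx_coord => i j; rewrite mxE.
under eq_fun do rewrite mxE.
apply: cvg_big => [|k _]; first exact: add_continuous.
apply: cvgM; first exact: (cvg_comp _ _ fa (@coord_continuous _ _ _ i k a)).
exact: (cvg_comp _ _ gb (@coord_continuous _ _ _ k j b)).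
Qed.

Lemma mulmxr_continuous m n p (A : 'M[R]_(n, p)) :
  continuous (mulmxr A : 'M[R]_(m, n) -> 'M[R]_(m, p)).
Proof.
by move=> x; exact: (@cvg_mulmx _ (nbhs x) _ m n p id (cst A) x A cvg_id (cvg_cst A)).
Qed.

Lemma dotC n (x y : 'rV[R]_n) : dot x y = dot y x.
Proof. by apply: eq_bigr => i _; rewrite mulrC. Qed.

Lemma dotE n (x y : 'rV[R]_n) : dot x y = (x *m y^T) 0 0.
Proof. by rewrite mxE; apply: eq_bigr => i _; rewrite mxE. Qed.

Lemma dotDr n (x y z : 'rV[R]_n) : dot x (y + z) = dot x y + dot x z.
Proof. by rewrite -big_split; apply: eq_bigr => i _; rewrite mxE mulrDr. Qed.

Lemma dotZr n (x y : 'rV[R]_n) a : dot x (a *: y) = a * dot x y.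
Proof. by rewrite /dot mulr_sumr; apply: eq_bigr => i _; rewrite mxE mulrCA. Qed.

Lemma dotZl n (x y : 'rV[R]_n) a : dot (a *: x) y = a * dot x y.
Proof. by rewrite dotC dotZr dotC. Qed.

Lemma dotNr n (x y : 'rV[R]_n) : dot x (- y) = - dot x y.
Proof. by rewrite -scaleN1r dotZr mulN1r. Qed.

Lemma dot0r n (x : 'rV[R]_n) : dot x 0 = 0.
Proof. by rewrite -(scale0r 0) dotZr mul0r. Qed.

Lemma dot_ge0 n (x : 'rV[R]_n) : 0 <= dot x x.
Proof. by apply: sumr_ge0 => i _; rewrite -expr2 sqr_ge0. Qed.

Lemma dot_le0_eq0 n (x : 'rV[R]_n) : dot x x <= 0 -> x = 0.
Proof.
move=> le0; have : dot x x == 0 by rewrite eq_le le0 dot_ge0.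
rewrite psumr_eq0 => [/allP H|i _]; last by rewrite -expr2 sqr_ge0.
apply/rowP => i; rewrite mxE; apply/eqP; rewrite -sqrf_eq0 expr2.
by apply: H; rewrite mem_index_enum.
Qed.

Lemma dotBB n (x y : 'rV[R]_n) : dot (x - y) (x - y) = dot x x - 2 * dot x y + dot y y.
Proof.
by rewrite dotDr dotNr ![dot (x - y) _]dotC !dotDr !dotNr (dotC y x); ring.
Qed.

Lemma dot_norm_le n (x y : 'rV[R]_n) : `|dot x y| <= n%:R * (`|x| * `|y|).
Proof.
apply: le_trans (ler_norm_sum _ _ _) _.
rewrite mulr_natl -[n in _ *+ n]card_ord -sumr_const.
by apply: ler_sum => i _; rewrite normrM ler_pM // le_coord_norm.
Qed.

Lemma dot_mulmx n m (x : 'rV[R]_n) (A : 'M[R]_(n, m)) (y : 'rV[R]_m) :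
  dot (x *m A) y = dot x (y *m A^T).
Proof. by rewrite !dotE trmx_mul trmxK mulmxA. Qed.

End Matrices.

Section Gradients.
Context {R : realType}.

(** [grad] is made of partial derivatives; under differentiability it
    represents the full differential. *)
Lemma diff_grad n (h : 'rV[R]_n -> R) (x v : 'rV[R]_n) :
  differentiable h x -> 'd h x v = dot (grad h x) v.
Proof.
move=> dh; rewrite {1}(row_sum_delta v) linear_sum; apply: eq_bigr => i _.
by rewrite linearZ mxE deriveE // [RHS]mulrC.
Qed.

Lemma grad_eq n (h : 'rV[R]_n -> R) (x c : 'rV[R]_n) :
  (forall v, 'D_v h x = dot c v) -> grad h x = c.
Proof.
move=> H; apply/rowP => i; rewrite mxE H /dot (bigD1 i) //= mxE !eqxx mulr1.
by rewrite big1 ?addr0 // => j /negPf ji; rewrite mxE eqxx ji mulr0.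
Qed.

Lemma grad_comp n m (h : 'rV[R]_m -> R) (k : 'rV[R]_n -> 'rV[R]_m) x :
  differentiable k x -> differentiable h (k x) ->
  grad (h \o k) x = grad h (k x) *m jac k x.
Proof.
move=> dk dh; apply: grad_eq => v.
have dhk : differentiable (h \o k) x by exact: differentiable_comp.
rewrite deriveE // diff_comp //= diff_grad // dot_mulmx trmxK.
by rewrite -deriveE // deriveEjacobian.
Qed.

Lemma gradD n (h1 h2 : 'rV[R]_n -> R) x :
  differentiable h1 x -> differentiable h2 x ->
  grad (h1 + h2) x = grad h1 x + grad h2 x.
Proof.
move=> d1 d2; apply: grad_eq => v; rewrite deriveD; do ?exact: diff_derivable.
by rewrite !deriveE // !diff_grad // ![dot _ v]dotC dotDr.
Qed.

Lemma grad_cst n (c : R) (x : 'rV[R]_n) : grad (cst c) x = 0.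
Proof.
by apply: grad_eq => v; rewrite derive_cst dotC dot0r.
Qed.

Lemma dotl_differentiable n (c x : 'rV[R]_n) : differentiable (fun y => dot y c) x.
Proof.
have -> : (fun y => dot y c) = \sum_(i < n) (c 0 i *: (fun y : 'rV[R]_n => y 0 i)).
  apply/funext => y; rewrite fct_sumE; apply: eq_bigr => i _.
  by rewrite mulrC.
apply: differentiable_sum => i; apply: differentiableZ.
exact: differentiable_coord.
Qed.

Lemma dotl_continuous n (c : 'rV[R]_n) : continuous (fun y => dot y c).
Proof. by move=> x; apply: differentiable_continuous; exact: dotl_differentiable. Qed.

Lemma derive_affine n (x v : 'rV[R]_n) (s : R) :
  is_derive s 1 (fun s => x + s *: v) v.
Proof.
have -> : (fun s => x + s *: v) = cst x + ( *:%R^~ v) by [].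
have : is_derive s 1 (cst x + ( *:%R^~ v)) (0 + v).
  apply: is_deriveD.
  apply: DeriveDef.
    apply/derivable1_diffP.
    by apply: ex_diff.
  by rewrite deriveE // diff_val scale1r.
by rewrite add0r.
Qed.

Lemma is_derive_comp_grad n (h : 'rV[R]_n -> R) (x : R -> 'rV[R]_n) (s : R) v :
  differentiable h (x s) -> is_derive s 1 x v ->
  is_derive s 1 (h \o x) (dot (grad h (x s)) v).
Proof.
move=> dh [dx dxE].
have dx' : differentiable x s by apply/derivable1_diffP.
have dhx : differentiable (h \o x) s by exact: differentiable_comp.
apply: DeriveDef; first exact/derivable1_diffP.
by rewrite deriveE // diff_comp //= diff_grad // -deriveE // dxE.
Qed.

Lemma grad_dotl n (c x : 'rV[R]_n) : grad (fun y => dot y c) x = c.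
Proof.
apply: grad_eq => v; apply: cvg_lim => //.
apply: (@cvg_trans _ (cst (dot c v) @ 0^')); last exact: cvg_cst.
apply: near_eq_cvg; rewrite near_withinE; apply/nearW => h h0 /=.
rewrite ![dot _ c]dotC dotDr addrK dotZr.
by rewrite [_ *: _]mulKf.
Qed.

End Gradients.

(** * Projected gradient flows on a box *)

Section ProjectedGradient.
Context {R : realType}.

Lemma box_compact n (lo hi : 'rV[R]_n) : compact (box lo hi).
Proof.
exact: (@rV_compact R n (fun i => [set` `[lo 0 i, hi 0 i]%R])
  (fun i => @segment_compact _ _ _)).
Qed.

Lemma box_closed n (lo hi : 'rV[R]_n) : closed (box lo hi).
Proof. by apply: compact_closed; [exact: norm_hausdorff|exact: box_compact]. Qed.

Lemma box_segment n (lo hi x y : 'rV[R]_n) (s : R) : 0 <= s <= 1 ->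
  box lo hi x -> box lo hi y -> box lo hi (x + s *: (y - x)).
Proof.
move=> /andP[s0 s1] bx yb i; rewrite !mxE.
have := bx i; have := yb i => /andP[? ?] /andP[? ?].
by apply/andP; split; nra.
Qed.

(** The mean value theorem along segments of the box, on which the gradient is
    bounded by compactness.  It makes the cost along an absolutely continuous
    trajectory absolutely continuous. *)
Lemma C1_lipschitz_box n (lo hi : 'rV[R]_n) (h : 'rV[R]_n -> R) :
  C1_scalar h -> exists2 L, 0 < L & forall x y, box lo hi x -> box lo hi y ->
    `|h y - h x| <= L * `|y - x|.
Proof.
move=> [dh ch].
have /compact_bounded : compact (grad h @` box lo hi).
  by apply: continuous_compact; [exact: continuous_subspaceT|exact: box_compact].
move=> /pinfty_ex_gt0[M M0 HM].
exists (n%:R * M + 1) => [|x y bx yb].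
  by rewrite ltr_wpDl // mulr_ge0 // ltW.
pose z (s : R) := x + s *: (y - x).
have dz (s : R) : is_derive s 1 (h \o z) (dot (grad h (z s)) (y - x)).
  by apply: is_derive_comp_grad => //; exact: derive_affine.
have [|s] := @MVT_segment R (h \o z) _ 0 1 ler01 (fun s _ => dz s).
  apply: derivable_within_continuous => s _.
  by have [] := dz s.
have z1 : z 1 = y by rewrite /z scale1r addrC subrK.
have z0 : z 0 = x by rewrite /z scale0r addr0.
rewrite in_itv => s01 /=; rewrite z1 z0 subr0 mulr1 => ->.
apply: le_trans (dot_norm_le _ _) _.
rewrite mulrA ler_wpM2r // ler_wpDr // ler_wpM2l //.
by apply: HM; exists (z s) => //; exact: box_segment.
Qed.

Lemma enorm_le n (x y : 'rV[R]_n) : (enorm x <= enorm y) = (dot x x <= dot y y).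
Proof. by rewrite /enorm ler_sqrt // dot_ge0. Qed.

Lemma tangent_cone0 n (S : set 'rV[R]_n) x : S x -> tangent_cone S x 0.
Proof.
move=> Sx; apply: subset_closure; exists 1 => //=.
by exists x => //; rewrite subrr scaler0.
Qed.

(** [0] is in the tangent cone, so the projection [p] of [v] satisfies
    [|v - p| <= |v|], that is [|p|^2 <= 2 <v, p>]. *)
Lemma dot_tangent_proj_ge0 n (S : set 'rV[R]_n) x v : S x ->
  0 <= dot v (tangent_proj S x v).
Proof.
move=> Sx; rewrite /tangent_proj; case: xgetP => [p _ [_ /(_ 0 (tangent_cone0 Sx))]|_].
  by rewrite subr0 enorm_le dotBB; have := dot_ge0 p; lra.
by rewrite dot0r.
Qed.

(** On the polar of the tangent cone the same inequality
    [|p|^2 <= 2 <v, p>] forces [p = 0]. *)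
Lemma tangent_proj_polar n (S : set 'rV[R]_n) x v : S x ->
  (forall q, tangent_cone S x q -> dot v q <= 0) -> tangent_proj S x v = 0.
Proof.
move=> Sx polar; rewrite /tangent_proj.
case: xgetP => [p _ [Tp /(_ 0 (tangent_cone0 Sx))]|//].
rewrite subr0 enorm_le dotBB => H; apply: dot_le0_eq0.
by have := polar _ Tp; lra.
Qed.

(** The first-order condition: it holds in the feasible directions [s - w] and
    passes to the closed cone that they generate. *)
Lemma argmin_tangent n (lo hi : 'rV[R]_n) (h : 'rV[R]_n -> R) w :
  differentiable h w -> argmin (box lo hi) h w ->
  forall q, tangent_cone (box lo hi) w q -> 0 <= dot (grad h w) q.
Proof.
move=> dh [bw hmin].
pose P := [set q | 0 <= dot q (grad h w)].
have cP : closed P.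
  have := @continuous_closedP _ _ (fun q => dot q (grad h w)).
  by move=> [/(_ (@dotl_continuous _ _ _)) /(_ _ (@closed_ge R 0))].
suff sub : (\bigcup_(d in [set d : R | 0 < d]) [set d^-1 *: (s - w) | s in box lo hi])
    `<=` P.
  by move=> q /(closureS sub); rewrite -(closure_id P).1 // dotC.
move=> _ [d /= d0 [s bs <-]]; rewrite /P /= dotZl mulr_ge0 ?invr_ge0 ?(ltW d0) //.
rewrite dotC leNgt; apply/negP => lt0.
pose z (r : R) := w + r *: (s - w).
have z0 : z 0 = w by rewrite /z scale0r addr0.
have [dz dzE] : is_derive (0 : R) 1 (h \o z) (dot (grad h (z 0)) (s - w)).
  by apply: is_derive_comp_grad; [rewrite z0|exact: derive_affine].
rewrite z0 in dzE.
have := dz; rewrite /derivable -[X in _ @ _ --> X]/( 'D_1 (h \o z) 0) dzE.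
move=> /cvgrPdist_lt /(_ (- dot (grad h w) (s - w))).
rewrite oppr_gt0 => /(_ lt0); rewrite near_withinE => /nbhs_ballP[r /= r0 H].
pose t := Num.min (r / 2) 1.
have t0 : 0 < t by rewrite lt_min divr_gt0 // ltr01.
have := H t; rewrite /ball /= sub0r normrN gtr0_norm // gt_eqF //.
have -> : t < r by rewrite gt_min ltr_pdivrMr // ltr_pMr // ltr1n.
move=> /(_ isT isT); rewrite addr0 [t *: 1]mulr1 z0 -/(z t).
have hge : h w <= h (z t).
  by apply: hmin; apply: box_segment => //; rewrite (ltW t0) ge_min lexx orbT.
have q0 : 0 <= t^-1 *: (h (z t) - h w).
  by rewrite mulr_ge0 ?invr_ge0 ?(ltW t0) // subr_ge0.
by rewrite ltr_norml => /andP[+ _]; rewrite opprK ltrDl oppr_gt0 ltNge q0.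
Qed.

Lemma projected_gradient_equilibrium n (lo hi : 'rV[R]_n) (h : 'rV[R]_n -> R) w a :
  0 < a -> differentiable h w -> argmin (box lo hi) h w ->
  tangent_proj (box lo hi) w (- a *: grad h w) = 0.
Proof.
move=> a0 dh hw; apply: tangent_proj_polar; first by case: hw.
by move=> q /(argmin_tangent dh hw); rewrite dotZl mulNr oppr_le0; exact/mulr_ge0/ltW.
Qed.

(** The cost decreases at the rate [<grad h, x'>], and [x'] is the projection of
    [- a *: grad h], which has a non-negative product with its projection. *)
Lemma projected_gradient_descent n k (lo hi : 'rV[R]_n) (h : 'rV[R]_n -> R) a
    (F : 'rV[R]_n -> 'rV[R]_k -> 'rV[R]_n) c x0 x :
  0 < a -> C1_scalar h ->
  (forall v, F v c = tangent_proj (box lo hi) v (- a *: grad h v)) ->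
  solution (box lo hi) F x0 (fun=> c) x -> forall t, 0 <= t -> h (x t) <= h x0.
Proof.
move=> a0 hC1 FE [x00 xbox acx aex] t t0.
have [L L0 hL] := C1_lipschitz_box lo hi hC1.
rewrite -x00; apply: (@ae_derive_le0_nonincreasing R (h \o x)) => //.
  move=> e e0; have [d d0 H] := acx t (e / L) (divr_gt0 e0 L0).
  exists d => // N s r sr sep ltd.
  apply: (@le_lt_trans _ _ (L * \sum_(i < N) `|x (r i) - x (s i)|)).
    rewrite mulr_sumr; apply: ler_sum => i _; apply: hL; apply: xbox.
      by case: (sr i).
    by case: (sr i) => r0 [rs _]; exact: le_trans rs.
  by rewrite mulrC -ltr_pdivlMr //; apply: H.
apply: ae_sub aex => s dx s0; have {}dx := dx s0.
have [dhx dhxE] := is_derive_comp_grad (hC1.1 (x s)) dx.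
split=> //; rewrite dhxE FE.
have := @dot_tangent_proj_ge0 _ (box lo hi) (x s) (- a *: grad h (x s)) (xbox _ (ltW s0)).
by rewrite dotZl mulNr oppr_ge0 pmulr_rle0.
Qed.

Lemma equilibrium_solution n k (D : set 'rV[R]_n) (F : 'rV[R]_n -> 'rV[R]_k -> 'rV[R]_n)
    (w : 'rV[R]_n) c :
  D w -> F w c = 0 -> solution D F w (fun=> c) (fun=> w).
Proof.
move=> Dw Fw; split => //.
  move=> T e e0; exists 1 => // N s t _ _ _.
  by rewrite big1 // => i _; rewrite subrr normr0.
by apply: aeW => t t0; rewrite Fw; exact: is_derive_cst.
Qed.

End ProjectedGradient.

(** * Monotone systems and asymptotic bounds *)

Section MonotoneSystems.
Context {R : realType}.

Definition orthant n (eps : 'I_n -> bool) : set 'rV[R]_n :=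
  [set x | forall i, 0 <= (-1) ^+ (eps i) * x 0 i].

(** [orthant (neg eps)] is [- orthant eps].  Every order statement below is
    one-sided; lower bounds for [neg eps] are the upper bounds for [eps]. *)
Definition neg n (eps : 'I_n -> bool) : 'I_n -> bool := fun i => ~~ eps i.

Lemma negK n (eps : 'I_n -> bool) : neg (neg eps) = eps.
Proof. by apply/funext => i; rewrite /neg negbK. Qed.

Lemma orthant0 n (eps : 'I_n -> bool) : orthant eps 0.
Proof. by move=> i; rewrite mxE mulr0. Qed.

Lemma orthant_neg n (eps : 'I_n -> bool) x : orthant (neg eps) x <-> orthant eps (- x).
Proof.
by split=> H i; have := H i; rewrite /neg signrN mxE mulrN mulNr.
Qed.

Lemma succeq_neg n (eps : 'I_n -> bool) x y :
  succeq (orthant (neg eps)) x y <-> succeq (orthant eps) y x.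
Proof. by rewrite /succeq orthant_neg opprB. Qed.

(** The part of monotonicity that compares two trajectories with the same
    initial state. *)
Definition order_preserving n k (D : set 'rV[R]_n) (F : 'rV[R]_n -> 'rV[R]_k -> 'rV[R]_n)
    (eps1 : 'I_k -> bool) (eps2 : 'I_n -> bool) : Prop :=
  forall w w' x0 x x', admissible_input w -> admissible_input w' ->
    succeq_everywhere (orthant eps1) w w' ->
    solution D F x0 w x -> solution D F x0 w' x' ->
    forall t, 0 <= t -> succeq (orthant eps2) (x t) (x' t).

Lemma order_preserving_neg n k (D : set 'rV[R]_n) (F : 'rV[R]_n -> 'rV[R]_k -> 'rV[R]_n)
    (eps1 : 'I_k -> bool) (eps2 : 'I_n -> bool) :
  order_preserving D F eps1 eps2 -> order_preserving D F (neg eps1) (neg eps2).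
Proof.
move=> H w w' x0 x x' aw aw' le_w sx sx' t t0; apply/succeq_neg.
by apply: (H w' w) sx' sx t t0 => // s s0; apply/succeq_neg; exact: le_w.
Qed.

(** [a <= liminf x(t)], coordinatewise for the order of [orthant eps]. *)
Definition eventually_above n (eps : 'I_n -> bool) (x : R -> 'rV[R]_n) (a : 'rV[R]_n) :=
  forall e, 0 < e -> \forall t \near +oo,
    forall i, (-1) ^+ (eps i) * a 0 i - e <= (-1) ^+ (eps i) * x t 0 i.

Lemma sign_dist_lt n (eps : 'I_n -> bool) (a b : 'rV[R]_n) e i :
  `|a - b| < e -> (-1) ^+ (eps i) * a 0 i - e < (-1) ^+ (eps i) * b 0 i.
Proof.
move=> lte; have := le_lt_trans (le_coord_norm (a - b) 0 i) lte.
by rewrite !mxE ltr_norml => /andP[]; case: (eps i) => /=; rewrite ?expr1 ?expr0; lra.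
Qed.

Lemma eventually_above_closed n (eps : 'I_n -> bool) x (a : 'rV[R]_n) :
  (forall e, 0 < e -> exists2 b, `|a - b| < e & eventually_above eps x b) ->
  eventually_above eps x a.
Proof.
move=> H e e0; have e20 : 0 < e / 2 by rewrite divr_gt0.
have [b ab /(_ _ e20)] := H _ e20; apply: filterS => t xt i.
by have := sign_dist_lt eps i ab; have := xt i; lra.
Qed.

Lemma eventually_above_squeeze n (eps : 'I_n -> bool) x (a : 'rV[R]_n) :
  eventually_above eps x a -> eventually_above (neg eps) x a ->
  x t @[t --> +oo] --> a.
Proof.
move=> H1 H2; apply/cvgrPdist_lt => e e0.
have e20 : 0 < e / 2 by rewrite divr_gt0.
apply: filterS2 (H1 _ e20) (H2 _ e20) => t x1 x2.
apply: norm_lt_coord => // j i; rewrite (ord1 j) !mxE.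
have := x1 i; have := x2 i; rewrite /neg signrN ltr_norml.
case: (eps i) => /=; rewrite ?expr1 ?expr0 => ? ?; apply/andP; split; lra.
Qed.

(** A monotone system with a continuous steady-state map [kss] sends an
    asymptotic bound [a] on the input to the asymptotic bound [kss a] on the
    state: from some time [T] on, the input dominates the constant [b], slightly
    below [a], hence the state dominates the trajectory [z] with input [b]
    started at time [T], and [z] tends to [kss b], which is close to [kss a].
    Admissibility is required of the shifted inputs, the only ones to which
    well-posedness and monotonicity are applied. *)
Lemma eventually_above_steady_state n k (D : set 'rV[R]_n) F (kss : 'rV[R]_k -> 'rV[R]_n)
    (eps1 : 'I_k -> bool) (eps2 : 'I_n -> bool) x0 w x a :
  well_posed D F -> steady_state_map D F kss -> order_preserving D F eps1 eps2 ->
  (forall T, 0 <= T -> admissible_input (fun t => w (T + t))) ->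
  solution D F x0 w x ->
  eventually_above eps1 w a -> eventually_above eps2 x (kss a).
Proof.
move=> wpF [ckss kssP] ordF admw solx wa e e0.
have e20 : 0 < e / 2 by rewrite divr_gt0.
have /cvgrPdist_lt /(_ _ e20) /nbhs_ballP[d /= d0 kssd] := ckss a.
have d20 : 0 < d / 2 by rewrite divr_gt0.
pose b := \row_i (a 0 i - (-1) ^+ (eps1 i) * (d / 2)) : 'rV[R]_k.
have kab : `|kss a - kss b| < e / 2.
  apply: kssd; rewrite -ball_normE /=; apply: norm_lt_coord => // i' i.
  rewrite (ord1 i') !mxE opprB addrC subrK normrM normr_sign mul1r gtr0_norm //.
  by rewrite ltr_pdivrMr // ltr_pMr // ltr1n.
have [M [_ wM]] := wa _ d20.
pose T := Num.max M 0 + 1.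
have T0 : 0 <= T by rewrite addr_ge0 // le_max lexx orbT.
have MT : M < T.
  by rewrite (@le_lt_trans _ _ (Num.max M 0)) ?ltrDl // le_max lexx.
have solT := solution_shift T0 solx.
have DT : D (x T) by case: solx => _ Dx _ _; exact: Dx.
have [z solz _] := wpF (fun=> b) _ (cst_admissible b) DT.
have xz t : 0 <= t -> succeq (orthant eps2) (x (T + t)) (z t).
  apply: ordF solT solz t; [exact: admw|exact: cst_admissible|] => t t0 i.
  have := wM (T + t); rewrite ltr_wpDr // => /(_ isT i).
  rewrite !mxE; case: (eps1 i) => /=; rewrite ?expr1 ?expr0; lra.
have := kssP b _ DT _ solz => /cvgrPdist_lt /(_ _ e20) [M' [_ zM']].
exists (T + Num.max M' 0); split; first exact: num_real.
move=> t tM i.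
have t0 : 0 <= t - T.
  by rewrite subr_ge0 ltW // (le_lt_trans _ tM) // lerDl le_max lexx orbT.
have tM' : M' < t - T.
  by rewrite ltrBrDl (le_lt_trans _ tM) // lerD2l le_max lexx.
have := sign_dist_lt eps2 i kab; have := sign_dist_lt eps2 i (zM' _ tM').
have := xz _ t0 i; rewrite [T + _]addrC subrK !mxE mulrBr.
by lra.
Qed.

Lemma box_eventually_above n (eps : 'I_n -> bool) (lo hi : 'rV[R]_n) x :
  (forall t, 0 <= t -> box lo hi (x t)) ->
  eventually_above eps x (\row_i if eps i then hi 0 i else lo 0 i).
Proof.
move=> xbox e e0; exists 0; split => // t /ltW/xbox H i.
have /andP[? ?] := H i.
rewrite mxE; case: (eps i) => /=; rewrite ?expr1 ?expr0; lra.
Qed.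

End MonotoneSystems.

(** * The controller and its steady states *)

Section Cost.
Context {R : realType}.

(** Applied to [Phiu v + <ky v, c>], the
    objective of one step of the iteration. *)
Lemma C1_scalarD_comp n m (h1 : 'rV[R]_n -> R) (c : 'rV[R]_m) (k : 'rV[R]_n -> 'rV[R]_m) :
  C1_scalar h1 -> C1_vector k -> C1_scalar (h1 + ((fun y => dot y c) \o k)).
Proof.
move=> [d1 c1] [dk ck]; have dck v : differentiable ((fun y => dot y c) \o k) v.
  by apply: differentiable_comp => //; exact: dotl_differentiable.
split=> [v|]; first exact: differentiableD.
have -> : grad (h1 + ((fun y => dot y c) \o k)) = fun v => grad h1 v + c *m jac k v.
  apply/funext => v; rewrite gradD // grad_comp ?grad_dotl //.
  exact: dotl_differentiable.
move=> v; apply: (@cvgD _ _ _ _ _ (grad h1) (fun v => c *m jac k v) _ _ (c1 v)).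
exact: (@cvg_mulmx _ _ (nbhs v) _ _ _ _ (cst c) (jac k) c (jac k v) (cvg_cst c) (ck v)).
Qed.

Lemma C1_scalar_mulmxr n m (h : 'rV[R]_m -> R) (A : 'M[R]_(n, m)) (c : R) :
  C1_scalar h -> C1_scalar ((h \o mulmxr A) + cst c).
Proof.
move=> [dh ch].
have dA v : differentiable (mulmxr A : 'rV[R]_n -> 'rV[R]_m) v.
  by apply: linear_differentiable; exact: mulmxr_continuous.
have dhA v : differentiable (h \o mulmxr A) v by exact: differentiable_comp.
split=> [v|]; first exact: differentiableD.
have -> : grad ((h \o mulmxr A) + cst c) = fun v => grad h (mulmxr A v) *m A^T.
  apply/funext => v; rewrite gradD // grad_cst addr0 grad_comp //; congr (_ *m _^T).
  apply/row_matrixP => i; rewrite !rowE -deriveEjacobian // deriveE //.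
  by rewrite diff_lin //; exact: mulmxr_continuous.
move=> v.
apply: (@cvg_mulmx _ _ (nbhs v) _ _ _ _ (grad h \o mulmxr A) (cst A^T) _ _ _ (cvg_cst _)).
exact: cvg_comp (@mulmxr_continuous _ _ _ _ A v) (ch _).
Qed.

(** [Phiu] and [Phiy] are, up to constants, the restrictions of the joint cost to
    the coordinate subspaces [y = 0] and [u = 0]. *)
Lemma cost_assumption_C1 m p Phi (Phiu : 'rV[R]_m -> R) (Phiy : 'rV[R]_p -> R) :
  cost_assumption Phi Phiu Phiy -> C1_scalar Phiu /\ C1_scalar Phiy.
Proof.
move=> [PhiE [PhiC1 _]]; split.
- have -> : Phiu = ((fun z : 'rV[R]_(m + p) => Phi (lsubmx z) (rsubmx z))
      \o mulmxr (row_mx 1%:M 0)) + cst (- Phiy 0).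
    apply/funext => u /=; rewrite !fctE /= mul_mx_row mulmx1 mulmx0.
    by rewrite row_mxKl row_mxKr PhiE addrK.
  exact: C1_scalar_mulmxr.
- have -> : Phiy = ((fun z : 'rV[R]_(m + p) => Phi (lsubmx z) (rsubmx z))
      \o mulmxr (row_mx 0 1%:M)) + cst (- Phiu 0).
    apply/funext => u /=; rewrite !fctE /= mul_mx_row mulmx1 mulmx0.
    by rewrite row_mxKl row_mxKr PhiE addrAC subrr add0r.
  exact: C1_scalar_mulmxr.
Qed.

End Cost.

Section Controller.
Context {R : realType} {n m p : nat}.
Variables (g : 'rV[R]_n -> 'rV[R]_p) (kx : 'rV[R]_m -> 'rV[R]_n).
Variables (Phiu : 'rV[R]_m -> R) (Phiy : 'rV[R]_p -> R) (lo hi : 'rV[R]_m).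
Variables (alpha : R) (kv : 'rV[R]_n -> 'rV[R]_m).
Let ky := g \o kx.
Let U := box lo hi.
Let V := controller_field alpha U Phiu Phiy ky g.
Hypothesis alpha0 : 0 < alpha.
Hypothesis Phiu_C1 : C1_scalar Phiu.
Hypothesis Phiy_C1 : C1_scalar Phiy.
Hypothesis ky_C1 : C1_vector ky.
Hypothesis kvP : steady_state_map U V kv.

(** Frozen at the steady state [kx w], the controller is a projected gradient flow
    of [Phiu + h \o ky] for any [h] whose gradient at [ky v] is that of [Phiy] at
    [ky w].  It is used with [h] linear, for all [v], and with [h = Phiy] at
    [v = w]. *)
Lemma controller_field_gradient (h : 'rV[R]_p -> R) w v :
  differentiable h (ky v) -> grad h (ky v) = grad Phiy (ky w) ->
  V v (kx w) = tangent_proj U v (- alpha *: grad (Phiu + (h \o ky)) v).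
Proof.
move=> dh ghE; have dky := ky_C1.1 v.
have dhk : differentiable (h \o ky) v by exact: differentiable_comp.
rewrite (gradD (Phiu_C1.1 v) dhk) (grad_comp dky dh) ghE scalerDr.
by rewrite [- alpha *: (_ *m _)]scaleNr.
Qed.

(** The linearized cost decreases along the frozen controller, which tends to
    [kv (kx w)] from every initial point [v0]; hence its value at the limit is
    at most its value at [v0]. *)
Lemma steady_state_argmin w : well_posed U V -> U w ->
  argmin U (fun v => Phiu v + dot (ky v) (grad Phiy (ky w))) (kv (kx w)).
Proof.
move=> wpV Uw; set c := grad _ _.
pose h := Phiu + ((fun y => dot y c) \o ky).
have hC1 : C1_scalar h by exact: C1_scalarD_comp.
have VE v : V v (kx w) = tangent_proj U v (- alpha *: grad h v).
  apply: controller_field_gradient; first exact: dotl_differentiable.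
  by rewrite grad_dotl.
have cvg_kv v0 (Uv0 : U v0) : exists2 v : R -> 'rV[R]_m, v t @[t --> +oo] --> kv (kx w) &
    forall t, 0 <= t -> U (v t) /\ h (v t) <= h v0.
  have [v solv _] := wpV (fun=> kx w) v0 (cst_admissible _) Uv0.
  exists v; first exact: kvP.2 solv.
  move=> t t0; split; first by case: solv => _ /(_ _ t0).
  exact: (projected_gradient_descent alpha0 hC1 VE solv).
split.
  have [v cv vU] := cvg_kv _ Uw.
  apply: (closed_cvg _ (@box_closed _ _ lo hi) _ _ cv).
  by exists 0; split => // t /ltW/vU[].
move=> v0 Uv0; have [v cv vU] := cvg_kv _ Uv0.
have ch : h (v t) @[t --> +oo] --> h (kv (kx w)).
  by apply: cvg_comp cv _; exact/differentiable_continuous/hC1.1.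
apply: (closed_cvg _ (@closed_le _ (h v0)) _ _ ch).
by exists 0; split => // t /ltW/vU[].
Qed.

(** The linearized cost at [w] and the true cost have the same gradient at [w].
    A minimizer of the true cost is therefore a rest point of the controller
    frozen at [kx w], and the constant trajectory can only tend to [w]. *)
Lemma minimizer_fixed_point w :
  argmin U (fun u => Phiu u + Phiy (ky u)) w -> kv (kx w) = w.
Proof.
move=> minw; have Uw : U w by case: minw.
have dPhi : differentiable (Phiu + (Phiy \o ky)) w.
  apply: differentiableD; first exact: Phiu_C1.1.
  by apply: differentiable_comp; [exact: ky_C1.1|exact: Phiy_C1.1].
have Vw : V w (kx w) = 0.
  rewrite (@controller_field_gradient Phiy) //; last exact: Phiy_C1.1.
  exact: projected_gradient_equilibrium.
have /(kvP.2 _ _ Uw) cw := equilibrium_solution Uw Vw.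
apply: (cvg_unique _ cw (cvg_cst w)); exact: norm_hausdorff.
Qed.

Lemma minimizer_exists : U lo ->
  exists w, argmin U (fun u => Phiu u + Phiy (ky u)) w.
Proof.
move=> Ulo; have [|||w Uw wmin] := @compact_EVT_min _ R (Phiu + (Phiy \o ky)) U.
- by exists lo.
- exact: box_compact.
- apply: continuous_subspaceT => v; apply: differentiable_continuous.
  apply: differentiableD; first exact: Phiu_C1.1.
  by apply: differentiable_comp; [exact: ky_C1.1|exact: Phiy_C1.1].
by exists w; split=> [|v Uv]; [exact: set_mem|exact/wmin/mem_set].
Qed.

End Controller.

(** * Convergence of the closed loop *)

Theorem theorem1 (R : realType) (n m p : nat)
  (f : 'rV[R]_n -> 'rV[R]_m -> 'rV[R]_n) (g : 'rV[R]_n -> 'rV[R]_p)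
  (kx : 'rV[R]_m -> 'rV[R]_n) (ky : 'rV[R]_m -> 'rV[R]_p)
  (Phi : 'rV[R]_m -> 'rV[R]_p -> R)
  (Phiu : 'rV[R]_m -> R) (Phiy : 'rV[R]_p -> R)
  (umin umax : 'rV[R]_m)
  (KU : set 'rV[R]_m) (KX : set 'rV[R]_n) (KY : set 'rV[R]_p)
  (alpha : R) (kv : 'rV[R]_n -> 'rV[R]_m) (ustar : 'rV[R]_m) :
  let U := box umin umax in
  let V := controller_field alpha U Phiu Phiy ky g in
  plant_assumption f g kx ky ->
  cost_assumption Phi Phiu Phiy ->
  (forall i, umin 0 i <= umax 0 i) ->
  is_orthant KU -> is_orthant KX -> is_orthant KY ->
  monotone_system setT f g (succeq_ae KU) KX KY ->
  0 < alpha ->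
  (* (i) *)
  (exists KV : set 'rV[R]_m, is_orthant KV /\
     monotone_system U V id (succeq_everywhere KX) KV [set - z | z in KU]) ->
  (* (ii) *)
  steady_state_map U V kv ->
  (* (iii) *)
  unique (fun us => U us /\ iteration_converges_to U Phiu Phiy ky us) ustar ->
  unique (argmin U (fun u => Phiu u + Phiy (ky u))) ustar /\
  forall (x0 : 'rV[R]_n) (u0 : 'rV[R]_m), U u0 ->
  forall (x : R -> 'rV[R]_n) (u : R -> 'rV[R]_m),
    solution setT f x0 u x -> solution U V u0 x u ->
    x t @[t --> +oo] --> kx ustar /\ u t @[t --> +oo] --> ustar.
Proof.
move=> U V [_ [_ [kxP [kyE [ky_C1 _]]]]] cost lohi [eU ->] [eX ->] _.
move=> [wpf monof _] alpha0 [KV [[eV ->] [wpV monoV outV]]] kvP [[Uus itus] _].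
have [Phiu_C1 Phiy_C1] := cost_assumption_C1 cost.
subst ky.
have kv_argmin w : U w -> argmin U
    (fun v => Phiu v + dot ((g \o kx) v) (grad Phiy ((g \o kx) w))) (kv (kx w)).
  by move=> Uw; exact: (steady_state_argmin alpha0 Phiu_C1 ky_C1 kvP wpV Uw).
(* The discrete loop: [iter j kappa w] is an instance of the iteration. *)
pose kappa w := kv (kx w).
have kappaU w : U w -> U (kappa w) by move=> /kv_argmin[].
have kappa_cvg w : U w -> (fun j => iter j kappa w) @ \oo --> ustar.
  move=> Uw; apply: itus => //= j; apply: kv_argmin.
  by elim: j => //= j; exact: kappaU.
(* A minimizer is a fixed point of [kappa], so the constant sequence is an
   instance of the iteration. *)
have min_eq w : argmin U (fun u => Phiu u + Phiy ((g \o kx) u)) w -> w = ustar.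
  move=> minw; have wE := minimizer_fixed_point alpha0 Phiu_C1 Phiy_C1 ky_C1 kvP minw.
  have Uw : U w by case: minw.
  have := kappa_cvg _ Uw; have -> : (fun j => iter j kappa w) = fun=> w.
    by apply/funext => j; elim: j => //= j ->; exact: wE.
  by move=> cw; apply: (cvg_unique _ (cvg_cst w) cw); exact: norm_hausdorff.
split.
  have Ulo : U umin by move=> i; rewrite lexx lohi.
  have [w minw] := minimizer_exists Phiu_C1 Phiy_C1 ky_C1 Ulo.
  split; last by move=> v /min_eq.
  by rewrite -(min_eq _ minw).
move=> x0 u0 Uu0 x u solx solu.
have admx T : 0 <= T -> admissible_input (fun t => x (T + t)).
  by move=> T0; exact: solution_admissible (solution_shift T0 solx).
have admu T : 0 <= T -> admissible_input (fun t => u (T + t)).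
  by move=> T0; exact: solution_admissible (solution_shift T0 solu).
have ordf : order_preserving setT f eU eX.
  move=> w w' z0 z z' aw aw' le_w; apply: monof => //.
    exact: aeW.
  by rewrite /succeq subrr; exact: orthant0.
have ordV : order_preserving U V eX (neg eU).
  move=> w w' z0 z z' aw aw' le_w solz solz' t t0.
  have [_ Uz _ _] := solz; have [_ Uz' _ _] := solz'.
  have Uz0 : U z0 by case: solz => <- /(_ _ (lexx 0)).
  have le_z0 : succeq (orthant eV) z0 z0 by rewrite /succeq subrr; exact: orthant0.
  have := outV _ _ (Uz t t0) (Uz' t t0)
    (monoV _ _ _ _ aw aw' le_w Uz0 Uz0 le_z0 _ _ solz solz' t t0).
  rewrite /succeq => -[y Ky <-].
  by apply/orthant_neg; rewrite opprK.
pose loop e1 e2 := order_preserving setT f e1 e2 /\ order_preserving U V e2 (neg e1).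
have loop_neg e1 e2 : loop e1 e2 -> loop (neg e1) (neg e2).
  by move=> [? ?]; split; exact: order_preserving_neg.
have above_x e1 e2 a : loop e1 e2 -> eventually_above e1 u a ->
    eventually_above e2 x (kx a).
  by move=> [ord1 _]; exact: eventually_above_steady_state wpf kxP ord1 admu solx.
(* Negative feedback: one turn of the loop exchanges lower and upper bounds. *)
have above_kappa e1 e2 a : loop e1 e2 -> eventually_above e1 u a ->
    eventually_above (neg e1) u (kappa a).
  move=> le /(above_x _ _ _ le); case: le => _ ord2.
  exact: eventually_above_steady_state wpV kvP ord2 admx solu.
have above_ustar e1 e2 : loop e1 e2 -> eventually_above e1 u ustar.
  move=> le; pose a := \row_i (if e1 i then umax 0 i else umin 0 i).
  have Ua : U a by move=> i; rewrite mxE; case: ifP => _; rewrite lexx lohi.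
  (* The even iterates stay on the same side; [a] is the smallest corner of the
     box for [orthant e1]. *)
  have even j : eventually_above e1 u (iter j.*2 kappa a).
    elim: j => [|j IH]; first by apply: box_eventually_above; case: solu.
    rewrite doubleS /= -[e1]negK; apply: (above_kappa _ _ _ (loop_neg _ _ le)).
    exact: (above_kappa _ _ _ le IH).
  apply: eventually_above_closed => e e0.
  have /cvgrPdist_lt /(_ _ e0) [N _ HN] := kappa_cvg _ Ua.
  exists (iter N.*2 kappa a) => //; apply: HN => /=.
  by rewrite -addnn leq_addr.
have le : loop eU eX by [].
split; last first.
  apply: (@eventually_above_squeeze _ _ eU); first exact: above_ustar le.
  exact: above_ustar (loop_neg _ _ le).
apply: (@eventually_above_squeeze _ _ eX).
  exact: above_x le (above_ustar _ _ le).
exact: above_x (loop_neg _ _ le) (above_ustar _ _ (loop_neg _ _ le)).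
Qed.
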